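(* Let $\gamma$ be a composition of $n$. For any composition $\alpha\le\gamma$ of $n$, the function $\blacktriangledown\mathbf{R}^{(\gamma)}_\alpha\left(A;\frac1t\right)$ is positive, up to a global sign, in the $\gamma$-Schur basis in the parameter $1/t$. More precisely, $$\blacktriangledown\,\mathbf{R}^{(\gamma)}\left(A;\frac1t\right)=\left(\bigotimes_{i\in D(\gamma)}\begin{bmatrix}t^i\end{bmatrix}\ \otimes\bigotimes_{i\notin D(\gamma)}\begin{bmatrix}0&-t^iq^{n-i}\\1&t^i+q^{n-i}\end{bmatrix}\right)\mathbf{R}^{(\gamma)}\left(A;\frac1t\right),$$ where $i$ ranges over $\{1,\ldots,n-1\}$ and the entries of the column vector $\mathbf{R}^{(\gamma)}$ are ordered by $\phi_\gamma$.
   Context: A composition $\alpha=(\alpha_1,\ldots,\alpha_{l(\alpha)})$ of $n$ (written $\alpha\models n$) is a sequence of positive integers with sum $n$; $l(\alpha)$ is its length. Its descent set is $D(\alpha)=\{\alpha_1,\alpha_1+\alpha_2,\ldots,\alpha_1+\cdots+\alpha_{l(\alpha)-1}\}\subseteq\{1,\ldots,n-1\}$; this gives a bijection between compositions of $n$ and subsets of $\{1,\ldots,n-1\}$. Refinement order: $\alpha\le\beta$ iff $D(\beta)\subseteq D(\alpha)$. Complement: $D(\alpha^c)=\{1,\ldots,n-1\}\setminus D(\alpha)$. Reverse: $\overleftarrow{\alpha}=(\alpha_{l(\alpha)},\ldots,\alpha_1)$. Conjugate: $\alpha'=\overleftarrow{\alpha^c}$. For compositions of $n$: $c(\alpha,\beta)=\sum_{i\in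 D(\alpha)\cap D(\beta)}i$, $n(\alpha)=\sum_{i\in D(\alpha)}i$. $\mathbf{Sym}=\mathbb{C}(q,t)\langle\mathbf{h}_1,\mathbf{h}_2,\ldots\rangle$ is the free associative algebra; $\mathbf{h}_\alpha(A)=\mathbf{h}_{\alpha_1}\cdots\mathbf{h}_{\alpha_{l(\alpha)}}$; ribbon Schur functions: $\mathbf{R}_\alpha(A)=\sum_{\beta\ge\alpha}(-1)^{l(\alpha)-l(\beta)}\mathbf{h}_\beta(A)$. Modified non-commutative Macdonald polynomials: $\widetilde{\mathbf{H}}_\alpha(A;q,t)=\sum_{\beta\models n}t^{c(\alpha,\beta)}q^{c(\alpha',\overleftarrow{\beta})}\mathbf{R}_\beta(A)$ for $\alpha\models n$; these form a basis. The operator $\blacktriangledown$ is the $\mathbb{C}(q,t)$-linear operator with $\blacktriangledown(\widetilde{\mathbf{H}}_\alpha(A;q,t))=t^{n(\alpha)}q^{n(\alpha')}\widetilde{\mathbf{H}}_\alpha(A;q,t)$ for all $\alpha$. For compositions $\alpha\le\gamma$ of $n$, the $\gamma$-Schur (or $\gamma$-ribbon Schur) function is $$\mathbf{R}_\alpha^{(\gamma)}(A;t)=\sum_{\substack{\beta\ge\alpha\\ D(\alpha)\setminus D(\beta)\subseteq D(\gamma)}}t^{c(\alpha,\beta^c)}\mathbf{R}_\beta(A),$$ and $\mathbf{R}_\alpha^{(\gamma)}(A;1/t)$ is obtained by replacing $t$ by $1/t$. The $\gamma$-Schur basis in the parameter $1/t$ is $\{\mathbf{R}_\alpha^{(\gamma)}(A;1/t)\}_{\alpha\le\gamma}$.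 ''Positive up to a global sign'' means that, after multiplying by a single sign $\pm1$ (depending on $\alpha$), all coefficients are polynomials in $q,t$ with nonnegative integer coefficients. Ordering: write $D(\gamma)=\{i_1<\cdots<i_k\}$ and $D(\gamma^c)=\{j_1<\cdots<j_{n-1-k}\}$, let $\sigma_\gamma$ be the permutation of $\{1,\ldots,n-1\}$ with $\sigma_\gamma(i_s)=s$ and $\sigma_\gamma(j_r)=k+r$, and set $\phi_\gamma(\alpha)=\sum_{i\in D(\alpha)}2^{\sigma_\gamma(i)-1}$. $\mathbf{R}^{(\gamma)}(A;1/t)$ denotes the column vector of the $\mathbf{R}_\alpha^{(\gamma)}(A;1/t)$, $\alpha\le\gamma$, listed by increasing $\phi_\gamma(\alpha)$; $\blacktriangledown$ is applied entrywise. Tensor product convention: $B\otimes C=[c_{ij}B]_{i,j}$ (block matrix with blocks $c_{ij}B$). The tensor factors indexed by $i\in D(\gamma)$ come first, then those indexed by $i\notin D(\gamma)$, in each group in increasing order of $i$. *)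

(* Defs.v *)
From HB Require Import structures.
From mathcomp Require Import all_boot all_order all_algebra.
From mathcomp Require Import complex mxtens reals.
From mathcomp Require Import monalg.

Set Implicit Arguments.
Unset Strict Implicit.
Unset Printing Implicit Defensive.

Import GRing.Theory.
Local Open Scope ring_scope.

Definition is_composition (n : nat) (s : seq nat) : bool :=
  (0%N \notin s) && (sumn s == n).

Record composition (n : nat) :=
  Composition { parts : seq nat; partsP : is_composition n parts }.

HB.instance Definition _ (n : nat) := [isSub for @parts n].
HB.instance Definition _ (n : nat) := [Countable of composition n by <:].

(* {1, ..., n-1}, as a subset of 'I_n = {0, ..., n-1}. *)
Definition ground (n : nat) : {set 'I_n} := [set i : 'I_n | (0 < i)%N].

(* The partial sums of all parts but the last; they are all less than n. *)
Definition Dset (n : nat) (a : composition n) : {set 'I_n} :=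
  [set i : 'I_n | (i : nat) \in take (size (parts a)).-1 (scanl addn 0%N (parts a))].

(* The parts are the successive differences of the elements of S :&: {1..n-1}
   followed by n; for n = 0 the sequence is empty. *)
Definition parts_of_set (n : nat) (S : {set 'I_n}) : seq nat :=
  pairmap (fun x y => (y - x)%N) 0%N
    [seq i <- iota 1 n | (i \in [seq val j | j in S]) || (i == n)].

Lemma parts_of_setP (n : nat) (S : {set 'I_n}) :
  is_composition n (parts_of_set S).
Proof.
rewrite /is_composition /parts_of_set.
set s := [seq i <- _ | _].
have sum_diff x l : path leq x l ->
    (sumn (pairmap (fun x y => (y - x)%N) x l) + x = last x l)%N.
  elim: l x => [//|y l IHl] x /= /andP[le_xy pl].
  by rewrite -(IHl y pl) addnAC addnC subnK // addnC.
have pos_diff x l : path ltn x l ->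
    0%N \notin pairmap (fun x y => (y - x)%N) x l.
  elim: l x => [//|y l IHl] x /= /andP[lt_xy pl].
  by rewrite inE negb_or IHl // andbT eq_sym -lt0n subn_gt0.
have pth : path ltn 0%N s.
  rewrite path_min_sorted; first exact/(sorted_filter ltn_trans)/iota_ltn_sorted.
  by apply/allP => i; rewrite mem_filter mem_iota => /andP[_ /andP[]].
rewrite pos_diff //=.
have := sum_diff 0%N s (sub_path ltnW pth); rewrite addn0 => ->.
case: n S @s pth {sum_diff pos_diff} => [|n] S s _; first by [].
rewrite /s; have -> : iota 1 n.+1 = rcons (iota 1 n) n.+1.
  by rewrite -[in LHS](addn1 n) iotaD cats1 add1n.
by rewrite filter_rcons eqxx orbT last_rcons.
Qed.

Definition comp_of_set (n : nat) (S : {set 'I_n}) : composition n :=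
  Composition (parts_of_setP S).

Lemma DsetK (n : nat) : cancel (@Dset n) (@comp_of_set n).
Proof.
case=> p p_comp; apply: val_inj => /=.
have /andP[p_gt0 /eqP sum_p] := p_comp.
rewrite -[RHS](scanlK (f := fun x y => (y - x)%N) (g := addn) addKn 0%N).
rewrite /parts_of_set; congr pairmap.
have pth x l : 0%N \notin l -> path ltn x (scanl addn x l).
  elim: l x => [//|y l IHl] x; rewrite inE negb_or eq_sym -lt0n.
  move=> /andP[y_gt0 /(IHl (x + y)%N)] /= ->.
  by rewrite -[X in (X < _)%N]addn0 ltn_add2l y_gt0.
have lst x l : last x (scanl addn x l) = (x + sumn l)%N.
  by elim: l x => [|y l IHl] x /=; rewrite ?addn0 // IHl addnA.
have {pth} := pth 0%N p p_gt0; have {lst} := lst 0%N p; rewrite add0n sum_p.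
rewrite /Dset /= -(size_scanl addn 0%N p); move: (scanl _ _ _) => s.
case/lastP: s => [<- //|s m]; rewrite last_rcons => ->.
rewrite size_rcons -cats1 take_size_cat // cats1 => pth.
have pth' := path_sorted pth.
apply: (irr_sorted_eq ltn_trans ltnn _ pth').
  exact/(sorted_filter ltn_trans)/iota_ltn_sorted.
have [lt_sn gt_s0] : (forall i, i \in s -> i < n)%N /\
                    (forall i, i \in rcons s n -> 0 < i)%N.
  split=> [i si|]; last exact/allP/(order_path_min ltn_trans pth).
  move: pth'; rewrite (sorted_pairwise ltn_trans) pairwise_rcons => /andP[].
  by move=> /allP/(_ i si).
move=> i; rewrite mem_filter mem_iota add1n ltnS mem_rcons inE orbC.
apply/idP/predU1P => [/andP[/predU1P[->|/mapP[j sj ->]] _]|[->|si]].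
- by left.
- by right; rewrite mem_enum inE in sj.
- by rewrite eqxx leqnn andbT gt_s0 ?mem_rcons ?mem_head.
rewrite gt_s0 ?mem_rcons ?inE ?si ?orbT //= (ltnW (lt_sn i si)) andbT.
apply/orP; right; apply/mapP; exists (Ordinal (lt_sn i si)) => //.
by rewrite mem_enum inE.
Qed.

HB.instance Definition _ (n : nat) : isFinite (composition n) :=
  CanIsFinite (@DsetK n).

(* cle a b means a <= b: a refines b. *)
Definition cle (n : nat) (a b : composition n) : bool := Dset b \subset Dset a.

Definition compl (n : nat) (a : composition n) : composition n :=
  comp_of_set (ground n :\: Dset a).

Lemma rev_compP (n : nat) (a : composition n) :
  is_composition n (rev (parts a)).
Proof. by rewrite /is_composition mem_rev sumn_rev; exact: partsP. Qed.

Definition rev_comp (n : nat) (a : composition n) : composition n :=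
  Composition (rev_compP a).

Definition conj_comp (n : nat) (a : composition n) : composition n :=
  rev_comp (compl a).

Definition cstat (n : nat) (a b : composition n) : nat :=
  (\sum_(i in Dset a :&: Dset b) i)%N.

Definition nstat (n : nat) (a : composition n) : nat :=
  (\sum_(i in Dset a) i)%N.

(* The generator h_k is the letter k - 1; by convention h_0 = 1. *)
Definition Sym (F : fieldType) := {malg F[{fmonom nat}]}.

Definition hgen (F : fieldType) (k : nat) : Sym F :=
  if k is k'.+1 then << fmu k' >> else 1.

Definition hcomp (F : fieldType) (n : nat) (a : composition n) : Sym F :=
  \prod_(k <- parts a) hgen F k.

(* The truncated subtraction is exact: a <= b forces l(b) <= l(a). *)
Definition ribbon (F : fieldType) (n : nat) (a : composition n) : Sym F :=
  \sum_(b : composition n | cle a b)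
     (-1) ^+ (size (parts a) - size (parts b)) *: hcomp F b.

Definition macdonald (F : fieldType) (q t : F) (n : nat) (a : composition n) :
    Sym F :=
  \sum_(b : composition n)
     (t ^+ cstat a b * q ^+ cstat (conj_comp a) (rev_comp b)) *: ribbon F b.

(* The functions macdonald q t a form a basis of Sym over C(q,t), so exactly
   one linear operator satisfies this condition. *)
Definition is_nabla (F : fieldType) (q t : F)
    (nabla : {linear Sym F -> Sym F}) : Prop :=
  forall (n : nat) (a : composition n),
    nabla (macdonald q t a)
    = (t ^+ nstat a * q ^+ nstat (conj_comp a)) *: macdonald q t a.

Definition gamma_schur (F : fieldType) (t : F) (n : nat) (g a : composition n) :
    Sym F :=
  \sum_(b : composition n | cle a b && (Dset a :\: Dset b \subset Dset g))
     t ^+ cstat a (compl b) *: ribbon F b.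

(* The elements of D(g) in increasing order, then the other elements of
   {1, ..., n-1} in increasing order: sigma_g is the 1-based position in it. *)
Definition gamma_order (n : nat) (g : composition n) : seq 'I_n :=
  enum (Dset g) ++ enum (ground n :\: Dset g).

Definition sigma (n : nat) (g : composition n) (i : 'I_n) : nat :=
  (index i (gamma_order g)).+1.

Definition phi (n : nat) (g a : composition n) : nat :=
  (\sum_(i in Dset a) 2 ^ (sigma g i).-1)%N.

Definition below_sorted (n : nat) (g : composition n) : seq (composition n) :=
  sort (fun a b => (phi g a <= phi g b)%N)
       (enum [pred a : composition n | cle a g]).

Definition gamma_schur_vec (F : fieldType) (t : F) (n : nat)
    (g : composition n) : seq (Sym F) :=
  [seq gamma_schur t g a | a <- below_sorted g].

Definition sqmx (F : fieldType) : Type := {d : nat & 'M[F]_d}.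

Definition to_sqmx (F : fieldType) (d : nat) (A : 'M[F]_d) : sqmx F :=
  Tagged (fun d => 'M[F]_d) A.

(* Convention B (x) C = [c_ij B]_(i,j), whereas A *t B = [a_ij B]_(i,j). *)
Definition tens (F : fieldType) (B C : sqmx F) : sqmx F :=
  to_sqmx (tagged C *t tagged B).

Definition bigtens (F : fieldType) (s : seq (sqmx F)) : sqmx F :=
  foldl (@tens F) (to_sqmx (1%:M : 'M[F]_1)) s.

Definition nabla_factor (F : fieldType) (q t : F) (n : nat)
    (g : composition n) (i : 'I_n) : sqmx F :=
  if i \in Dset g then to_sqmx ((t ^+ i)%:M : 'M[F]_1)
  else to_sqmx (\matrix_(a < 2, b < 2)
    nth 0 (nth [::] [:: [:: 0; - (t ^+ i * q ^+ (n - i))];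
                        [:: 1; t ^+ i + q ^+ (n - i)     ]] a) b).

Definition nabla_matrix (F : fieldType) (q t : F) (n : nat)
    (g : composition n) : sqmx F :=
  bigtens [seq nabla_factor q t g i | i <- gamma_order g].

(* C(q,t), with C = R[i]: the inner variable is q, the outer one is t. *)
Definition Cqt (R : realType) : fieldType := {fraction {poly {poly R[i]}}}.

Definition qvar (R : realType) : Cqt R := tofrac ('X%:P).

Definition tvar (R : realType) : Cqt R := tofrac 'X.

(* Polynomials in q, t with nonnegative integer coefficients. *)
Definition nat_poly_qt (R : realType) (x : Cqt R) : Prop :=
  exists (d : nat) (m : nat -> nat -> nat),
    x = \sum_(i < d) \sum_(j < d) qvar R ^+ i * tvar R ^+ j *+ m i j.

Definition positive_up_to_sign (R : realType) (n : nat) (g : composition n)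
    (f : Sym (Cqt R)) : Prop :=
  exists (e : bool) (c : composition n -> Cqt R),
    (forall b, cle b g -> nat_poly_qt (c b)) /\
    (-1) ^+ e *: f
    = \sum_(b : composition n | cle b g) c b *: gamma_schur (tvar R)^-1 g b.

(* Main.v *)
Require Import Defs.
From HB Require Import structures.
From mathcomp Require Import all_boot all_order all_algebra.
From mathcomp Require Import complex mxtens reals.
From mathcomp Require Import monalg.
From mathcomp Require Import ring.

Set Implicit Arguments.
Unset Strict Implicit.
Unset Printing Implicit Defensive.
Import GRing.Theory.

Local Open Scope ring_scope.

(** Identify the ribbon functions of degree n with the pure tensors of basis
   vectors e_0, e_1 in a tensor product of planes indexed by 0 < i < n, where
   i is a descent exactly when the i-th factor is e_1. Then H_a is the tensor
   product of the vectors e_0 + x e_1, where x = t^i if i is a descent of a and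
   x = q^(n-i) otherwise, and its eigenvalue is the product of the x. Since
   t^i <> q^(n-i), nabla is the tensor product of the maps
   e_0 |-> - t^i q^(n-i) e_1 and e_1 |-> e_0 + (t^i + q^(n-i)) e_1.
   The gamma-Schur function of a is also a pure tensor: its i-th factor is the
   eigenvector e_1 + t^(-i) e_0 if i is in D(gamma), and a basis vector
   otherwise. The ordering by phi reads D(a) minus D(gamma) in binary, least
   significant bit first, which is the index convention of the tensor product. *)

(** * Descent sets of compositions, of their complements and of their reverses *)

Lemma DsetP (n : nat) (a : composition n) (i : 'I_n) :
  reflect (exists2 k, (0 < k < size (parts a))%N &
             i = sumn (take k (parts a)) :> nat)
          (i \in Dset a).
Proof.
(* [scanl] omits its starting value, so its entry [k] sums the first [k.+1] parts. *)
have scanE k : (k < size (parts a))%N ->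
    nth 0%N (scanl addn 0%N (parts a)) k = sumn (take k.+1 (parts a)).
  by move=> lt_k; rewrite nth_scanl // (foldl_foldr addnA addnC).
rewrite inE; apply: (iffP (nthP 0%N)) => [[k]|[[|k] //= lt_k ->]].
  rewrite size_take_min size_scanl leq_min => /andP[lt_k1 lt_k].
  rewrite nth_take // scanE // => <-; exists k.+1 => //.
  by case: (size _) lt_k1.
exists k; last by rewrite nth_take ?scanE ?(ltnW lt_k) // ltn_predRL.
by rewrite size_take_min size_scanl leq_min ltn_predRL lt_k ltnW.
Qed.

Lemma sumn_parts n (a : composition n) : sumn (parts a) = n.
Proof. by have /andP[_ /eqP] := partsP a. Qed.

Lemma Dset_ground n (a : composition n) : Dset a \subset ground n.
Proof.
apply/subsetP => i /DsetP[k /andP[k_gt0 lt_k] i_def]; rewrite inE i_def.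
have /andP[p_gt0 _] := partsP a.
case: (parts a) p_gt0 k k_gt0 lt_k {i_def} => [|x s]; first by move=> _ [].
rewrite inE negb_or eq_sym -lt0n => /andP[x_gt0 _] [|k] //= _ _.
exact: ltn_addr.
Qed.

(** Partial sums undo successive differences, and the final [n] is what [take] drops. With [DsetK]
    this makes compositions correspond to subsets of [ground n]. *)
Lemma comp_of_setK n (S : {set 'I_n}) :
  S \subset ground n -> Dset (comp_of_set S) = S.
Proof.
move=> /subsetP S_gt0; apply/setP => i; rewrite inE /= /parts_of_set.
set s := [seq j <- _ | _].
have scan_s x l : path leq x l ->
    scanl addn x (pairmap (fun x y => (y - x)%N) x l) = l.
  by elim: l x => [//|y l IHl] x /= /andP[le_xy /IHl]; rewrite subnKC // => ->.
rewrite scan_s ?size_pairmap; last first.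
  rewrite path_min_sorted; last exact/allP.
  exact/(sub_sorted ltnW)/(sorted_filter ltn_trans)/iota_ltn_sorted.
have def_s : s = rcons [seq j <- iota 1 n.-1 | j \in [seq val j | j in S]] n.
  case: n S S_gt0 i @s => [|n] S S_gt0 i s; first by case: i.
  rewrite /s; have -> : iota 1 n.+1 = rcons (iota 1 n) n.+1.
    by rewrite -[in LHS](addn1 n) iotaD cats1 add1n.
  rewrite filter_rcons eqxx orbT; congr rcons; apply: eq_in_filter => j.
  by rewrite mem_iota => /andP[_]; rewrite add1n => /ltn_eqF->; rewrite orbF.
rewrite def_s size_rcons -cats1 take_size_cat // mem_filter mem_iota.
rewrite mem_image; last exact: val_inj.
case Si: (i \in S) => //=; move: (S_gt0 i Si); rewrite inE => i_gt0.
by rewrite i_gt0 add1n (ltn_predK (ltn_ord i)) ltn_ord.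
Qed.

Lemma Dset_compl n (a : composition n) : Dset (compl a) = ground n :\: Dset a.
Proof. by rewrite comp_of_setK // subsetDl. Qed.

Lemma ground_rev n (i : 'I_n) : i \in ground n -> (n - i < n)%N.
Proof.
by rewrite inE => i_gt0; rewrite ltn_subrL i_gt0 (leq_trans _ (ltn_ord i)).
Qed.

(* [insubd] makes [flip] fix 0, so that it is an involution of all of ['I_n]. *)
Definition flip n (i : 'I_n) : 'I_n := insubd i (n - i)%N.

Lemma val_flip n (i : 'I_n) : i \in ground n -> flip i = (n - i)%N :> nat.
Proof. by move=> /ground_rev lt_i; rewrite /flip val_insubd lt_i. Qed.

Lemma flip_ground n (i : 'I_n) : (flip i \in ground n) = (i \in ground n).
Proof.
rewrite !inE val_insubd /=; case: (posnP i) => [i0|i_gt0].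
  by rewrite i0 subn0 ltnn.
by rewrite ltn_subrL i_gt0 (leq_trans _ (ltn_ord i)) //= subn_gt0 ltn_ord.
Qed.

Lemma flipK n : involutive (@flip n).
Proof.
move=> i; apply/val_inj; have [gi|/negPf i0] := boolP (i \in ground n).
  by rewrite /= !val_flip ?flip_ground // subKn // ltnW.
have : flip (flip i) \notin ground n by rewrite !flip_ground i0.
by move: i0; rewrite !inE -leqNgt lt0n leqn0 /= => /negbFE/eqP-> /eqP.
Qed.

(** A prefix and the suffix that completes it have sums adding up to [n]. One inclusion suffices,
    since reversal and [flip] are involutions. *)
Lemma Dset_rev n (a : composition n) (i : 'I_n) : i \in ground n ->
  (i \in Dset (rev_comp a)) = (flip i \in Dset a).
Proof.
have sub_rev (b : composition n) j : j \in ground n ->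
    j \in Dset b -> flip j \in Dset (rev_comp b).
  move=> gj /DsetP[k /andP[k_gt0 lt_k] j_def]; apply/DsetP.
  exists (size (parts b) - k)%N.
    by rewrite /= size_rev subn_gt0 lt_k ltn_subrL k_gt0 (leq_trans _ lt_k).
  rewrite val_flip //= take_rev subKn 1?ltnW // sumn_rev j_def.
  have := sumn_parts b; rewrite -{1}(cat_take_drop k (parts b)) sumn_cat.
  by move=> sum_n; rewrite -[RHS](addKn (sumn (take k (parts b)))) sum_n.
move=> gi; have revK : rev_comp (rev_comp a) = a.
  by apply: val_inj; rewrite /= revK.
apply/idP/idP => [/(sub_rev _ _ gi)|]; first by rewrite revK.
by move=> /sub_rev; rewrite flip_ground flipK; exact.
Qed.

Lemma sum_flip n (P Q : pred 'I_n) :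
  {in ground n, forall i, P (flip i) = Q i} ->
  (\sum_(i in ground n | P i) i = \sum_(i in ground n | Q i) (n - i))%N.
Proof.
move=> PQ; rewrite (reindex_inj (inv_inj (@flipK n))) /=.
apply: eq_big => [i|i /andP[]]; rewrite flip_ground.
  by have [/PQ ->|//] := boolP (i \in ground n).
by move=> gi _; rewrite val_flip.
Qed.

(** The descents of the conjugate are the [n - i] with [i] a non-descent of [a]; hence the powers
    [q ^+ (n - i)]. *)
Lemma nstat_conj n (a : composition n) :
  nstat (conj_comp a) = (\sum_(i in ground n | i \notin Dset a) (n - i))%N.
Proof.
rewrite /nstat -(@sum_flip n (mem (Dset (conj_comp a)))).
  apply: eq_bigl => i; apply/idP/andP => [Di|[]//].
  by split=> //; apply: subsetP Di; exact: Dset_ground.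
move=> i gi; rewrite /= /conj_comp Dset_rev ?flip_ground // flipK.
by rewrite Dset_compl in_setD gi andbT.
Qed.

Lemma cstat_conj n (a b : composition n) :
  cstat (conj_comp a) (rev_comp b) =
  (\sum_(i in ground n | (i \notin Dset a) && (i \in Dset b)) (n - i))%N.
Proof.
rewrite /cstat -(@sum_flip n (mem (Dset (conj_comp a) :&: Dset (rev_comp b)))).
  apply: eq_bigl => i; apply/idP/andP => [Di|[]//].
  split=> //; move: Di; rewrite inE => /andP[Di _].
  by apply: subsetP Di; exact: Dset_ground.
move=> i gi; rewrite /= in_setI /conj_comp !Dset_rev ?flip_ground // flipK.
by rewrite Dset_compl in_setD gi andbT.
Qed.

(** * Sums over compositions and pure tensors *)

Lemma reindex_Dset (V : nmodType) n (f : {set 'I_n} -> V) :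
  \sum_(a : composition n) f (Dset a) =
  \sum_(S : {set 'I_n} | S \subset ground n) f S.
Proof.
rewrite [RHS](reindex_onto (@Dset n) (@comp_of_set n)) => [|S].
  by apply: eq_bigl => a; rewrite Dset_ground DsetK eqxx.
exact: comp_of_setK.
Qed.

Lemma prod_add_Dset (F : comNzSemiRingType) n (x y : 'I_n -> F) :
  \prod_(i in ground n) (x i + y i) =
  \sum_(a : composition n)
     \prod_(i in ground n) (if i \in Dset a then x i else y i).
Proof.
(* Outside [ground n] the values 0 and 1 make each factor 1 and kill every subset that is not
   contained in [ground n]. *)
pose x' i := if i \in ground n then x i else 0.
pose y' i := if i \in ground n then y i else 1.
rewrite (reindex_Dset (fun S =>
  \prod_(i in ground n) if i \in S then x i else y i)).
transitivity (\prod_i (x' i + y' i)).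
  rewrite big_mkcond; apply: eq_bigr => i _; rewrite /x' /y'.
  by case: ifP; rewrite ?add0r.
rewrite bigA_distr (bigID (fun S : {set 'I_n} => S \subset ground n)) /=.
rewrite [X in _ + X]big1 ?addr0 => [|S /subsetPn[i Si gi]].
  apply: eq_bigr => S /subsetP gS; rewrite [RHS]big_mkcond /=.
  apply: eq_bigr => i _; rewrite /x' /y'.
  by case Si: (i \in S) => //; rewrite (gS _ Si).
by rewrite (bigD1 i) //= Si /x' (negPf gi) mul0r.
Qed.

(* [congr (_ *: _)] is prohibitively slow on [Sym F]: it unfolds
   the algebra structure. *)
Lemma eq_scale (F : pzRingType) (V : lmodType F) (x y : F) (v w : V) :
  x = y -> v = w -> x *: v = y *: w.
Proof. by move=> -> ->. Qed.

(** The pure tensor whose [i]-th factor has coordinate [f i false] along e_0 and [f i true] along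
    e_1. *)
Definition tensor_ribbon (F : fieldType) n (f : 'I_n -> bool -> F) : Sym F :=
  \sum_(b : composition n)
     (\prod_(i in ground n) f i (i \in Dset b)) *: ribbon F b.

Lemma eq_tensor_ribbon (F : fieldType) n (f1 f2 : 'I_n -> bool -> F) :
  {in ground n, forall i, f1 i =1 f2 i} -> tensor_ribbon f1 = tensor_ribbon f2.
Proof.
move=> eq_f; apply: eq_bigr => b _; apply: (eq_scale _ (erefl _)).
by apply: eq_bigr => i gi; rewrite eq_f.
Qed.

(** Multilinearity in all factors at once: the descents of [a] mark the factors from which the [x]
    term is taken. *)
Lemma tensor_ribbonD (F : fieldType) n (u v : 'I_n -> F)
    (x y : 'I_n -> bool -> F) :
  tensor_ribbon (fun i e => u i * x i e + v i * y i e) =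
  \sum_(a : composition n)
     (\prod_(i in ground n) if i \in Dset a then u i else v i) *:
     tensor_ribbon (fun i => if i \in Dset a then x i else y i).
Proof.
rewrite /tensor_ribbon; under [RHS]eq_bigr do rewrite scaler_sumr.
rewrite exchange_big /=; apply: eq_bigr => b _.
rewrite prod_add_Dset scaler_suml; apply: eq_bigr => a _.
rewrite scalerA -big_split /=; apply: (eq_scale _ (erefl _)).
by apply: eq_bigr => i _; case: ifP.
Qed.

(** * The action of nabla on pure tensors and on gamma-Schur functions *)

Section Nabla.
Variables (F : fieldType) (q t : F) (n : nat).

Definition eigen (a : composition n) (i : 'I_n) : F :=
  if i \in Dset a then t ^+ i else q ^+ (n - i).

Lemma eigenE (a : composition n) :
  t ^+ nstat a * q ^+ nstat (conj_comp a) = \prod_(i in ground n) eigen a i.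
Proof.
rewrite nstat_conj /nstat -!prodrXr [RHS](bigID (mem (Dset a))) /=; congr (_ * _).
  rewrite -(eq_bigl _ _ (fun i => in_setI i _ _)) (setIidPr (Dset_ground a)).
  by apply: eq_bigr => i Di; rewrite /eigen Di.
by apply: eq_bigr => i /andP[_ /negPf Di]; rewrite /eigen Di.
Qed.

(** A descent [i] of [b] contributes [t ^+ i] through the first statistic if it is a descent of [a],
    and [q ^+ (n - i)] through the second otherwise. *)
Lemma macdonaldE (a : composition n) :
  macdonald q t a = tensor_ribbon (fun i e => if e then eigen a i else 1).
Proof.
apply: eq_bigr => b _; apply: (eq_scale _ (erefl _)).
rewrite cstat_conj /cstat -!prodrXr -big_mkcondr /=.
rewrite [RHS](bigID (mem (Dset a))) /=; congr (_ * _); last first.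
  apply: eq_big => [i|i /and3P[_ Da _]]; first by rewrite andbAC andbA.
  by rewrite /eigen (negPf Da).
apply: eq_big => [i|i]; rewrite inE; last by case/andP=> Da _; rewrite /eigen Da.
rewrite andbC -andbA; case Da: (i \in Dset a); last by rewrite !andbF.
by rewrite (subsetP (Dset_ground a)).
Qed.

Variable nabla : {linear Sym F -> Sym F}.
Hypothesis nablaP : is_nabla q t nabla.
Hypothesis qt_neq : {in ground n, forall i : 'I_n, t ^+ i != q ^+ (n - i)}.

(* On each tensor factor, nabla has eigenvectors (1, t^i) and (1, q^(n-i)). *)
Lemma nabla_tensor_ribbon (f : 'I_n -> bool -> F) :
  nabla (tensor_ribbon f) =
  tensor_ribbon (fun i e => if e
    then (t ^+ i + q ^+ (n - i)) * f i true - t ^+ i * q ^+ (n - i) * f i false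
    else f i true).
Proof.
(* Cramer's rule: [u i] and [v i] are the coordinates of the [i]-th factor in the eigenbasis, whose
   determinant is [d i]. *)
pose d (i : 'I_n) := t ^+ i - q ^+ (n - i).
pose u (i : 'I_n) := (f i true - q ^+ (n - i) * f i false) / d i.
pose v (i : 'I_n) := (t ^+ i * f i false - f i true) / d i.
pose x (i : 'I_n) (e : bool) := if e then t ^+ i else 1.
pose y (i : 'I_n) (e : bool) := if e then q ^+ (n - i) else 1.
have xyE (a : composition n) :
    tensor_ribbon (fun i => if i \in Dset a then x i else y i) = macdonald q t a.
  rewrite macdonaldE; apply: eq_tensor_ribbon => i _ e.
  by rewrite /x /y /eigen; case: ifP.
transitivity (tensor_ribbon (fun i e =>
    (t ^+ i * u i) * x i e + (q ^+ (n - i) * v i) * y i e)); last first.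
  apply: eq_tensor_ribbon => i gi [] /=; rewrite /u /v /d;
  have := qt_neq gi; rewrite -subr_eq0 => d_neq0; by field.
have -> : tensor_ribbon f =
    tensor_ribbon (fun i e => u i * x i e + v i * y i e).
  apply: eq_tensor_ribbon => i gi [] /=; rewrite /u /v /d;
  have := qt_neq gi; rewrite -subr_eq0 => d_neq0; by field.
rewrite !tensor_ribbonD linear_sum; apply: eq_bigr => a _.
rewrite linearZ /= xyE nablaP scalerA eigenE -big_split /=.
apply: (eq_scale _ (erefl _)).
by apply: eq_bigr => i _; rewrite /eigen; case: ifP; rewrite mulrC.
Qed.

(** On [Dset g] the factor can ignore [a]: all these [i] are descents of [a] when [cle a g]. *)
Definition schur_factor (g a : composition n) (i : 'I_n) (e : bool) : F :=
  if i \in Dset g then (if e then 1 else t^-1 ^+ i)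
  else (e == (i \in Dset a))%:R.

(** A descent of [a] in [Dset g] may be dropped at the price [t^-1 ^+ i]; elsewhere [b] must agree
    with [a], or a factor vanishes. *)
Lemma gamma_schurE (g a : composition n) : cle a g ->
  gamma_schur t^-1 g a = tensor_ribbon (schur_factor g a).
Proof.
move=> /subsetP le_ag; rewrite /gamma_schur /tensor_ribbon.
rewrite [RHS](bigID (fun b =>
  cle a b && (Dset a :\: Dset b \subset Dset g))) /=.
rewrite [X in _ + X]big1 ?addr0.
  apply: eq_bigr => b /andP[/subsetP le_ab /subsetP sub_g].
  apply: (eq_scale _ (erefl _)).
  rewrite /cstat Dset_compl -prodrXr.
  rewrite [RHS](bigID (mem (Dset a :&: (ground n :\: Dset b)))) /=.
  rewrite [X in _ = _ * X]big1 ?mulr1 => [|i /andP[gi]].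
    apply: eq_big => i; rewrite in_setI in_setD.
      by case: (i \in ground n); rewrite ?andbF.
    move=> /andP[Da /andP[Db gi]]; rewrite /schur_factor sub_g ?(negPf Db) //.
    by rewrite in_setD Da Db.
  rewrite in_setI in_setD gi andbT /schur_factor negb_and negbK.
  case Db: (i \in Dset b); first by rewrite le_ab // if_same.
  rewrite orbF => /negPf Da; rewrite Da eqxx; case: ifP => // /le_ag.
  by rewrite Da.
move=> b; apply: contraNeq => nz.
have sf i : i \in ground n -> i \notin Dset g -> (i \in Dset b) = (i \in Dset a).
  move=> gi /negPf Dg; apply/eqP; apply: contraNT nz => neq.
  by rewrite (bigD1 i) //= /schur_factor Dg (negPf neq) mul0r scale0r.
apply/andP; split; apply/subsetP => i.
  move=> Db; have gi := subsetP (Dset_ground b) i Db.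
  by have [/le_ag//|/sf<-] := boolP (i \in Dset g).
rewrite in_setD => /andP[Db Da]; have gi := subsetP (Dset_ground a) i Da.
by apply: contraNT Db => /sf ->.
Qed.

(** Rows and columns of the [i]-th matrix factor are indexed by booleans, [false] standing for 0; a
    1 by 1 factor ignores them. *)
Definition entry (g : composition n) (i : 'I_n) (e1 e2 : bool) : F :=
  if i \in Dset g then t ^+ i
  else if e1 then (if e2 then t ^+ i + q ^+ (n - i) else 1)
  else (if e2 then - (t ^+ i * q ^+ (n - i)) else 0).

Hypothesis t_neq0 : t != 0.

(** On [Dset g] the factor is an eigenvector of eigenvalue [t ^+ i]; elsewhere the image of a basis
    vector is a row of the 2 by 2 matrix. *)
Lemma nabla_gamma_schur (g a : composition n) : cle a g ->
  nabla (gamma_schur t^-1 g a) =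
  \sum_(b : composition n | cle b g)
    (\prod_(i in ground n) entry g i (i \in Dset a) (i \in Dset b)) *:
    gamma_schur t^-1 g b.
Proof.
move=> le_ag; rewrite gamma_schurE // nabla_tensor_ribbon.
(* The zero on [Dset g] removes from the multilinear expansion every [b] that is not below [g]. *)
pose e0 i := if i \in Dset g then 0 else entry g i (i \in Dset a) false.
pose e1 i := entry g i (i \in Dset a) true.
pose s b (i : 'I_n) e :=
  if i \in Dset g then (if e then 1 else t^-1 ^+ i) else (e == b)%:R : F.
transitivity
    (tensor_ribbon (fun i e => e1 i * s true i e + e0 i * s false i e)).
  apply: eq_tensor_ribbon => i gi e; rewrite /schur_factor /e0 /e1 /entry /s.
  case: (i \in Dset g).
    rewrite mul0r addr0; case: e; rewrite ?mulr1 ?exprVn ?divff ?expf_neq0 //.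
    by rewrite [t ^+ i * _]mulrC mulfK ?expf_neq0 // addrK.
  by case: (i \in Dset a); case: e => /=;
    rewrite !(mulr1, mulr0, addr0, add0r, sub0r, subr0).
rewrite (tensor_ribbonD e1 e0 (s true) (s false)).
rewrite [RHS]big_mkcond; apply: eq_bigr => b _.
case: ifPn => [/[dup] le_bg /subsetP sub_b|/subsetPn[i Dg Db]]; last first.
  rewrite (bigD1 i) ?(subsetP (Dset_ground g)) //=.
  by rewrite (negPf Db) /e0 Dg mul0r scale0r.
apply: eq_scale; last rewrite (gamma_schurE le_bg).
  apply: eq_bigr => i _; rewrite /e1 /e0; have := sub_b i.
  case: (i \in Dset b) => //; case: (i \in Dset g) => //.
  by move=> /(_ isT).
apply: eq_tensor_ribbon => i _ e; rewrite /s /schur_factor.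
by case: (i \in Dset b).
Qed.

End Nabla.

(** * Binary codes and the entries of iterated tensor products *)

(* The number whose k-th binary digit, from the least significant one, tells
   whether P holds at the k-th entry of s. *)
Definition code (T : eqType) (s : seq T) (P : pred T) : nat :=
  (\sum_(x <- s) P x * 2 ^ index x s)%N.

Lemma code_cat (T : eqType) (s1 s2 : seq T) (P : pred T) : uniq (s1 ++ s2) ->
  code (s1 ++ s2) P = (code s1 P + 2 ^ size s1 * code s2 P)%N.
Proof.
rewrite cat_uniq => /and3P[_ /hasPn s12 _]; rewrite /code big_cat /=.
congr (_ + _)%N; first by apply: eq_big_seq => x s1x; rewrite index_cat s1x.
rewrite big_distrr; apply: eq_big_seq => x s2x /=.
by rewrite index_cat (negPf (s12 x s2x)) expnD mulnCA.
Qed.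

Lemma code_rcons (T : eqType) (s : seq T) (x : T) (P : pred T) :
  uniq (rcons s x) -> code (rcons s x) P = (P x * 2 ^ size s + code s P)%N.
Proof.
move=> us; rewrite -cats1 code_cat ?cats1 // /code big_seq1 /= eqxx muln1.
by rewrite addnC mulnC.
Qed.

Lemma ltn_code (T : eqType) (s : seq T) (P : pred T) :
  uniq s -> (code s P < 2 ^ size s)%N.
Proof.
elim/last_ind: s => [|s x IHs]; first by rewrite /code big_nil.
move=> us; rewrite code_rcons // size_rcons expnS mul2n -addnn.
have := IHs (subseq_uniq (subseq_rcons s x) us).
by case: (P x); rewrite ?mul1n ?mul0n ?ltn_add2l ?add0n // => /ltn_addr->.
Qed.

Lemma code_inj (T : eqType) (s : seq T) (P Q : pred T) :
  uniq s -> code s P = code s Q -> {in s, P =1 Q}.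
Proof.
elim/last_ind: s => [|s x IHs] // /[dup] us; rewrite !code_rcons // => us'.
have {us'} us' := subseq_uniq (subseq_rcons s x) us.
have code_divn (R : pred T) :
    ((R x * 2 ^ size s + code s R) %/ 2 ^ size s = R x)%N.
  by rewrite divnMDl ?expn_gt0 // divn_small ?addn0 ?ltn_code.
move=> eqPQ; have PQx : P x = Q x.
  have : P x = Q x :> nat by rewrite -code_divn eqPQ code_divn.
  by case: (P x); case: (Q x).
move=> y; rewrite mem_rcons inE => /predU1P[->//|]; apply: IHs => //.
by apply/eqP; rewrite -(eqn_add2l (P x * 2 ^ size s)) eqPQ PQx.
Qed.

Lemma bigtens_rcons (F : fieldType) (s : seq (sqmx F)) (X : sqmx F) :
  bigtens (rcons s X) = tens (bigtens s) X.
Proof. by rewrite /bigtens -cats1 foldl_cat. Qed.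

(** The last factor is the outer block matrix, so its indices are the leading digits. The size is a
    power of 2 only up to a proved equality, so indices are compared with codes as numbers. *)
Lemma bigtens_nabla_factor (F : fieldType) (q t : F) n (g : composition n)
    (s : seq 'I_n) :
  uniq s ->
  let s' := [seq i <- s | i \notin Dset g] in
  let M := bigtens [seq nabla_factor q t g i | i <- s] in
  tag M = (2 ^ size s')%N /\
  forall (P Q : pred 'I_n) (i j : 'I_(tag M)),
    i = code s' P :> nat -> j = code s' Q :> nat ->
    tagged M i j = \prod_(l <- s) entry q t g l (P l) (Q l).
Proof.
elim/last_ind: s => [|s x IHs] us /=.
  by split=> // P Q i j _ _; rewrite big_nil !ord1 mxE.
have /IHs[] := subseq_uniq (subseq_rcons s x) us.
rewrite map_rcons bigtens_rcons filter_rcons /=.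
set M := bigtens _; set s' := filter _ _ => tagM entM.
(* A 1 by 1 factor adds no digit; a 2 by 2 factor adds one, split off by division by [tag M]. *)
have [Dx|nDx] /= := boolP (x \in Dset g).
  rewrite /nabla_factor Dx /=; split=> [|P Q i j def_i def_j].
    by rewrite mul1n.
  rewrite !mxE big_rcons mulrC /=; congr (_ * _).
    by apply: entM; rewrite /= modn_small // (leq_trans (ltn_ord _)) ?mul1n.
  by rewrite /entry Dx !ord1 eqxx mulr1n.
have us' : uniq (rcons s' x).
  by have := filter_uniq (fun i => i \notin Dset g) us; rewrite filter_rcons nDx.
have us'' := subseq_uniq (subseq_rcons s' x) us'.
rewrite /nabla_factor (negPf nDx) /=; split=> [|P Q i j].
  by rewrite size_rcons expnS tagM.
rewrite !code_rcons // => def_i def_j.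
have divE (R : pred 'I_n) : ((R x * 2 ^ size s' + code s' R) %/ tag M = R x)%N.
  by rewrite tagM divnMDl ?expn_gt0 // divn_small ?addn0 ?ltn_code.
have modE (R : pred 'I_n) :
    ((R x * 2 ^ size s' + code s' R) %% tag M = code s' R)%N.
  by rewrite tagM modnMDl modn_small ?ltn_code.
rewrite !mxE big_rcons mulrC; congr (_ * _).
  by apply: entM; rewrite /= ?def_i ?def_j modE.
rewrite /= def_i def_j !divE /entry (negPf nDx).
by case: (P x); case: (Q x).
Qed.

(** * The order by [phi] on the compositions below gamma *)

Section BelowSorted.
Variables (n : nat) (g : composition n).

Definition free_seq : seq 'I_n := enum (ground n :\: Dset g).

Definition free_code (a : composition n) : nat := code free_seq (mem (Dset a)).

Lemma gamma_order_uniq : uniq (gamma_order g).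
Proof.
rewrite cat_uniq !enum_uniq /= andbT; apply/hasPn => i.
by rewrite !mem_enum in_setD => /andP[].
Qed.

Lemma mem_gamma_order : gamma_order g =i ground n.
Proof.
move=> i; rewrite mem_cat !mem_enum in_setD.
by case Dg: (i \in Dset g) => //=; rewrite (subsetP (Dset_ground g)).
Qed.

Lemma filter_gamma_order :
  [seq i <- gamma_order g | i \notin Dset g] = free_seq.
Proof.
rewrite filter_cat (eq_in_filter (a2 := pred0)) => [|i].
  rewrite filter_pred0; apply/all_filterP/allP => i.
  by rewrite mem_enum in_setD => /andP[].
by rewrite mem_enum => ->.
Qed.

(** All bits at [Dset g] are 1 and come first, so [phi] orders these compositions as [free_code]
    does. *)
Lemma phiE (a : composition n) : cle a g ->
  phi g a = (code (enum (Dset g)) predT + 2 ^ #|Dset g| * free_code a)%N.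
Proof.
move=> /subsetP le_ag; rewrite /free_code cardE.
have -> : code (enum (Dset g)) predT = code (enum (Dset g)) (mem (Dset a)).
  by apply: eq_big_seq => i; rewrite mem_enum => /le_ag /= ->.
rewrite -code_cat ?gamma_order_uniq // /code -/(gamma_order g).
rewrite big_uniq ?gamma_order_uniq //= /phi big_mkcond [RHS]big_mkcond.
apply: eq_bigr => i _; rewrite mem_gamma_order /sigma /=.
case Da: (i \in Dset a); last by rewrite mul0n if_same.
by rewrite (subsetP (Dset_ground a)) // mul1n.
Qed.

Lemma free_code_inj : {in [pred a | cle a g] &, injective free_code}.
Proof.
move=> a b le_ag le_bg /(code_inj (enum_uniq _)) eq_ab.
apply: (can_inj (@DsetK n)); apply/setP => i.
have [Dg|Dg] := boolP (i \in Dset g).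
  by rewrite (subsetP le_ag) // (subsetP le_bg).
have [gi|gi] := boolP (i \in ground n).
  by have := eq_ab i; rewrite mem_enum in_setD Dg gi => /(_ isT).
by rewrite !(contraNF (subsetP (Dset_ground _) i) gi).
Qed.

Lemma card_below : #|[pred a | cle a g]| = (2 ^ size free_seq)%N.
Proof.
(* In the expansion of the product of the [1 + y i], the term of [a] is 1 if [cle a g] and 0
   otherwise. *)
pose y (i : 'I_n) : nat := i \notin Dset g.
rewrite -sum1_card big_mkcond.
have : \prod_(i in ground n) (1 + y i) = (2 ^ size free_seq)%N.
  rewrite (big_setID (Dset g)) /= big1 ?mul1r => [|i]; last first.
    by rewrite in_setI /y => /andP[_ ->].
  rewrite -cardE -prod_nat_const; apply: eq_bigr => i.
  by rewrite in_setD /y => /andP[->].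
move=> <-; rewrite prod_add_Dset; apply: eq_bigr => a _; rewrite inE.
case: ifPn => [/subsetP le_ag|/subsetPn[i Dg Da]].
  rewrite big1 // => i _; rewrite /y; case: ifPn => // Da.
  by rewrite (contraNN (le_ag i) Da).
by rewrite (bigD1 i) ?(subsetP (Dset_ground g)) //= (negPf Da) /y Dg mul0r.
Qed.

Lemma size_below_sorted : size (below_sorted g) = (2 ^ size free_seq)%N.
Proof. by rewrite size_sort -cardE card_below. Qed.

(** The codes are distinct, bounded by the length of the list, and increasing by [phiE]; hence each
    is the position of its composition. *)
Lemma free_code_below_sorted :
  [seq free_code a | a <- below_sorted g] = iota 0 (2 ^ size free_seq).
Proof.
have le_g a : a \in below_sorted g -> cle a g.
  by rewrite mem_sort mem_enum.
have u_code : uniq [seq free_code a | a <- below_sorted g].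
  rewrite map_inj_in_uniq ?sort_uniq ?enum_uniq // => a b /le_g le_ag /le_g.
  exact: free_code_inj.
apply: (sorted_eq leq_trans anti_leq); last 1 first.
- apply: uniq_perm => //; first exact: iota_uniq.
  apply: (uniq_min_size u_code _ _).2; last first.
    by rewrite size_map size_below_sorted size_iota.
  move=> _ /mapP[a _ ->]; rewrite mem_iota /= add0n.
  exact/ltn_code/enum_uniq.
- rewrite sorted_map.
  apply: (sub_in_sorted (P := [pred a | cle a g])) (sort_sorted _ _).
  + move=> a b le_ag le_bg; rewrite !phiE // leq_add2l leq_pmul2l //.
    by rewrite expn_gt0.
  + by apply/allP => a /le_g.
  + by move=> a b; exact: leq_total.
- exact: iota_sorted.
Qed.

End BelowSorted.

(** * Separating q from t, and polynomials with nonnegative integer coefficients *)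

Section Positivity.
Variable R : realType.
Local Notation q := (qvar R).
Local Notation t := (tvar R).

Lemma tvar_neq0 : t != 0.
Proof. by rewrite tofrac_eq0 polyX_eq0. Qed.

(** In the outer variable t the left side has degree [i], while the right side is constant. *)
Lemma tvar_neq_qvar (i j : nat) : (0 < i)%N -> t ^+ i != q ^+ j.
Proof.
move=> i_gt0; rewrite -!rmorphXn tofrac_eq; apply/eqP.
move=> /(congr1 (size \o val)) /=; rewrite size_polyXn size_polyC => size_eq.
by case: eqP size_eq => _ // [i0]; rewrite i0 in i_gt0.
Qed.

Lemma nat_poly_qt0 : nat_poly_qt (0 : Cqt R).
Proof. by exists 0%N, (fun _ _ => 0%N); rewrite big_ord0. Qed.

Lemma nat_poly_qtX (i j : nat) : nat_poly_qt (q ^+ i * t ^+ j).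
Proof.
exists (maxn i j).+1, (fun k l => (k == i) && (l == j)).
have [lt_i lt_j] : (i < (maxn i j).+1 /\ j < (maxn i j).+1)%N.
  by rewrite !ltnS leq_maxl leq_maxr.
rewrite (bigD1 (Ordinal lt_i)) //= (bigD1 (Ordinal lt_j)) //= !eqxx mulr1n.
rewrite !big1 ?addr0 // => [k /negPf|l /negPf]; rewrite -val_eqE /= => neq.
  by rewrite big1 // => l _; rewrite neq mulr0n.
by rewrite neq mulr0n.
Qed.

Lemma nat_poly_qtD (x y : Cqt R) :
  nat_poly_qt x -> nat_poly_qt y -> nat_poly_qt (x + y).
Proof.
(* Padding with zero coefficients brings both sums to a common bound. *)
have pad (d d' : nat) (m : nat -> nat -> nat) : (d <= d')%N ->
    \sum_(i < d) \sum_(j < d) q ^+ i * t ^+ j *+ m i j =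
    \sum_(i < d') \sum_(j < d') q ^+ i * t ^+ j *+
       (if (i < d)%N && (j < d)%N then m i j else 0%N).
  move=> le_d; rewrite (big_ord_widen d'
    (fun i => \sum_(j < d) q ^+ i * t ^+ j *+ m i j)) //.
  rewrite big_mkcond; apply: eq_bigr => i _; case: ifP => _; last by rewrite big1.
  rewrite (big_ord_widen d' (fun j => q ^+ i * t ^+ j *+ m i j)) // big_mkcond.
  by apply: eq_bigr => j _; case: ifP.
move=> [d1 [m1 ->]] [d2 [m2 ->]].
rewrite (pad d1 _ m1 (leq_maxl d1 d2)) (pad d2 _ m2 (leq_maxr d1 d2)).
exists (maxn d1 d2), (fun i j =>
  (if (i < d1)%N && (j < d1)%N then m1 i j else 0%N) +
  (if (i < d2)%N && (j < d2)%N then m2 i j else 0%N))%N.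
rewrite -big_split; apply: eq_bigr => i _.
by rewrite -big_split; apply: eq_bigr => j _; rewrite mulrnDr.
Qed.

Lemma nat_poly_qt_sum (I : Type) (r : seq I) (f : I -> Cqt R) :
  (forall i, nat_poly_qt (f i)) -> nat_poly_qt (\sum_(i <- r) f i).
Proof.
by move=> f_nat; apply: big_ind => //; [exact: nat_poly_qt0|exact: nat_poly_qtD].
Qed.

Lemma nat_poly_qtMn (x : Cqt R) (k : nat) :
  nat_poly_qt x -> nat_poly_qt (x *+ k).
Proof.
move=> x_nat; elim: k => [|k IHk]; first exact: nat_poly_qt0.
by rewrite mulrS; exact: nat_poly_qtD.
Qed.

Lemma nat_poly_qtM (x y : Cqt R) :
  nat_poly_qt x -> nat_poly_qt y -> nat_poly_qt (x * y).
Proof.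
move=> [d1 [m1 ->]] [d2 [m2 ->]]; rewrite mulr_suml.
apply: nat_poly_qt_sum => i; rewrite mulr_suml; apply: nat_poly_qt_sum => j.
rewrite mulr_sumr; apply: nat_poly_qt_sum => k; rewrite mulr_sumr.
apply: nat_poly_qt_sum => l; rewrite mulrnAl mulrnAr mulrACA -!exprD.
by do 2!apply: nat_poly_qtMn; exact: nat_poly_qtX.
Qed.

Lemma nat_poly_qt_prod (I : Type) (r : seq I) (P : pred I) (f : I -> Cqt R) :
  (forall i, P i -> nat_poly_qt (f i)) -> nat_poly_qt (\prod_(i <- r | P i) f i).
Proof.
move=> f_nat; apply: big_ind => //; last exact: nat_poly_qtM.
by have := nat_poly_qtX 0 0; rewrite mul1r.
Qed.

(** The negative entry shares its row only with 0, so the sign depends on the row alone; this is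
    what makes the sign global. *)
Lemma entry_positive n (g : composition n) (i : 'I_n) (e1 e2 : bool) :
  nat_poly_qt ((-1) ^+ ((i \notin Dset g) && ~~ e1) * entry q t g i e1 e2).
Proof.
have tX k : nat_poly_qt (t ^+ k) by have := nat_poly_qtX 0 k; rewrite mul1r.
have qX k : nat_poly_qt (q ^+ k) by have := nat_poly_qtX k 0; rewrite mulr1.
rewrite /entry; case: (i \in Dset g); rewrite /= ?mul1r //.
case: e1; case: e2; rewrite /= ?mul1r.
- exact: nat_poly_qtD.
- exact: (tX 0%N).
- by rewrite mulN1r opprK; exact: nat_poly_qtM.
- by rewrite mulr0; exact: nat_poly_qt0.
Qed.

End Positivity.

Theorem theorem23 (R : realType)
    (nabla : {linear Sym (Cqt R) -> Sym (Cqt R)})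
    (nablaP : is_nabla (qvar R) (tvar R) nabla)
    (n : nat) (g : composition n) :
  (forall a : composition n, cle a g ->
     positive_up_to_sign g (nabla (gamma_schur (tvar R)^-1 g a))) /\
  (let M := nabla_matrix (qvar R) (tvar R) g in
   let v := gamma_schur_vec (tvar R)^-1 g in
   size v = tag M /\
   forall i : 'I_(tag M),
     nabla v`_i = \sum_(j < tag M) tagged M i j *: v`_j).
Proof.
have qt_neq : {in ground n, forall i : 'I_n, tvar R ^+ i != qvar R ^+ (n - i)}.
  by move=> i; rewrite inE; exact: tvar_neq_qvar.
have nablaE := nabla_gamma_schur nablaP qt_neq (tvar_neq0 R).
split=> [a le_ag|M v].
  (* Each non-descent of [a] outside [Dset g] selects a row with a sign; the parity of their number
     is the global sign. *)
  pose s := (\sum_(i in ground n) ((i \notin Dset g) && (i \notin Dset a)))%N.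
  exists (odd s), (fun b => \prod_(i in ground n)
    ((-1) ^+ ((i \notin Dset g) && (i \notin Dset a)) *
     entry (qvar R) (tvar R) g i (i \in Dset a) (i \in Dset b))).
  split=> [b _|]; first by apply: nat_poly_qt_prod => i _; exact: entry_positive.
  rewrite nablaE // signr_odd scaler_sumr; apply: eq_bigr => b _.
  by rewrite scalerA big_split /= prodrXr.
have [tagM entM] := bigtens_nabla_factor (qvar R) (tvar R) g (gamma_order_uniq g).
rewrite -/(nabla_matrix _ _ g) -/M filter_gamma_order in tagM entM.
have size_v : size v = tag M by rewrite size_map size_below_sorted tagM.
split=> // i; pose a k := nth g (below_sorted g) k.
have size_s : size (below_sorted g) = tag M by rewrite -size_v size_map.
have vE (k : 'I_(tag M)) : v`_k = gamma_schur (tvar R)^-1 g (a k).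
  by rewrite (nth_map g) // size_s.
have codeE (k : 'I_(tag M)) : free_code g (a k) = k.
  rewrite /a -(nth_map g 0%N) ?size_s // free_code_below_sorted -tagM.
  by rewrite nth_iota.
have le_ag (k : 'I_(tag M)) : cle (a k) g.
  have : a k \in below_sorted g by rewrite mem_nth ?size_s.
  by rewrite mem_sort mem_enum.
have perm_s : perm_eq (below_sorted g) (enum [pred b | cle b g]).
  by rewrite perm_sort.
(* The sum over compositions below [g] becomes a sum over positions in the sorted list, which by
   [codeE] are the matrix indices. *)
rewrite vE nablaE // -[LHS]big_enum /= -(perm_big _ perm_s) /=.
rewrite (big_nth g) size_s big_mkord.
apply: eq_bigr => j _; rewrite vE; apply: (eq_scale _ (erefl _)).
rewrite (entM (mem (Dset (a i))) (mem (Dset (a j)))); try exact/esym/codeE.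
rewrite big_uniq ?gamma_order_uniq //=.
by apply: eq_bigl => l; rewrite mem_gamma_order.
Qed.
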